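(* Let $m$ be a positive integer and let $d=\gcd(3^m-2^m,\,2^m-1)$. The seed number is $S(m,2)=\min\left(\frac{3^m-1}{d},\,2^m+1\right)=s_0$, and the seed value is $V(m,2)=s_0 2^m$. Hence $T(s_0+j,m,2)=s_02^m+j$ for every integer $j\ge 0$.
   Context: For positive integers $n,m,t$, $T(n,m,t)$ denotes the least number that is the sum of $n$ positive $m$th powers (i.e. $\sum_{i=1}^n a_i^m$ with all $a_i$ positive integers) in at least $t$ ways, provided such a number exists. Two ways are regarded as different if they differ as multisets of terms (order is irrelevant). The seed number $S(m,t)$ is the smallest positive integer $s_0$ such that $T(n+1,m,t)=T(n,m,t)+1$ for all $n\ge s_0$ (in particular these values of $T$ exist), and the seed value is $V(m,t)=T(S(m,t),m,t)$. *)

(* Defs.v *)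
From mathcomp Require Import all_boot.

Set Implicit Arguments.
Unset Strict Implicit.
Unset Printing Implicit Defensive.

Definition is_way (n m v : nat) (w : seq nat) : bool :=
  [&& size w == n, all (fun a => 0 < a) w & \sum_(a <- w) a ^ m == v].

(* Ways are multisets: lists that are permutations of each other are the same
   way, so the [t] ways must be pairwise non-permutations. *)
Definition has_ways (n m t v : nat) : Prop :=
  exists ws : seq (seq nat),
    [/\ size ws = t, all (is_way n m v) ws
      & pairwise (fun w1 w2 => ~~ perm_eq w1 w2) ws].

(* T(n,m,t) is a partial function, given by its graph:
   [is_T n m t v] says that T(n,m,t) exists and equals [v]. *)
Definition is_T (n m t v : nat) : Prop :=
  has_ways n m t v /\ (forall u : nat, has_ways n m t u -> v <= u).

Definition seeded_from (m t s : nat) : Prop :=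
  forall n : nat, s <= n -> exists2 v : nat, is_T n m t v & is_T n.+1 m t v.+1.

(* S(m,t) exists and equals [s]. *)
Definition is_seed_number (m t s : nat) : Prop :=
  [/\ 0 < s, seeded_from m t s
    & forall s' : nat, 0 < s' -> seeded_from m t s' -> s <= s'].

(* V(m,t) exists and equals [v]. *)
Definition is_seed_value (m t v : nat) : Prop :=
  exists2 s : nat, is_seed_number m t s & is_T s m t v.

Lemma is_T_inj n m t v v' : is_T n m t v -> is_T n m t v' -> v = v'.
Proof.
by move=> [hv lv] [hv' lv']; apply/eqP; rewrite eqn_leq lv // lv'.
Qed.

Lemma is_seed_number_inj m t s s' :
  is_seed_number m t s -> is_seed_number m t s' -> s = s'.
Proof.
by move=> [p0 ps ls] [p0' ps' ls']; apply/eqP; rewrite eqn_leq ls // ls'.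
Qed.

(* The quotient (3^m - 1) / d in the formula for S(m,2) is exact. *)
Lemma dvdn_gcd_pow3 m : gcdn (3 ^ m - 2 ^ m) (2 ^ m - 1) %| 3 ^ m - 1.
Proof.
have le23 : 2 ^ m <= 3 ^ m by case: m => // m; rewrite leq_exp2r.
have -> : 3 ^ m - 1 = (3 ^ m - 2 ^ m) + (2 ^ m - 1).
  by rewrite addnBA ?expn_gt0 // subnK.
by rewrite dvdn_add ?dvdn_gcdl ?dvdn_gcdr.
Qed.

(* Main.v *)
Require Import Defs.
From mathcomp Require Import all_boot zify.

Set Implicit Arguments.
Unset Strict Implicit.

(** Replacing each term [a ^ m] by its excess [a ^ m - 1] makes terms equal to
    1 free: a sum of [n] positive powers with value [u] is a multiset of at
    most [n] excesses with total [u - n].  So one looks for the least total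
    excess reached in two ways, and for the number of terms that this takes.

    If all bases are at most 3, a way amounts to the pair (p, q) of its numbers
    of threes and twos, with total excess [p (3 ^ m - 1) + q (2 ^ m - 1)].  Two
    distinct pairs with equal totals differ by a multiple of the primitive
    solution of [x (3 ^ m - 1) = y (2 ^ m - 1)], so one of the ways has at least
    [(3 ^ m - 1) / d] twos ([many_twos]).  If some base is at least 4, the total
    excess is at least [4 ^ m - 1 = (2 ^ m + 1) (2 ^ m - 1)].  Either way the
    total is at least [s0 (2 ^ m - 1)], and this is attained: [s0] twos can be
    traded for one four, or for threes, together with ones.

    That fewer than [s0] terms never suffice at the minimal excess
    ([two_ways_bound]) is clear when all bases are at most 3, since one way
    then has at least [s0] twos.  Otherwise one way is a single four with ones
    and the other has [p] threes and [q] twos.  If [p = 0], it has [2 ^ m + 1]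
    twos.  If [p > 0], comparison with [2 ^ m + 1] twos forces [q = 0], hence
    [p (3 ^ m - 1) = 4 ^ m - 1], which is absurd because the left side is even
    and the right side is odd. *)

(** * Arithmetic of the excesses *)

Lemma subn_exp_gt0 a m : 1 < a -> 0 < m -> 0 < a ^ m - 1.
Proof. by move=> a1 m0; rewrite subn_gt0 -{1}(expn0 a) ltn_exp2l. Qed.

Lemma gcdn_pow3 m :
  gcdn (3 ^ m - 2 ^ m) (2 ^ m - 1) = gcdn (3 ^ m - 1) (2 ^ m - 1).
Proof.
have le23 : 2 ^ m <= 3 ^ m by case: m => // m; rewrite leq_exp2r.
have -> : 3 ^ m - 1 = (3 ^ m - 2 ^ m) + (2 ^ m - 1).
  by rewrite addnBA ?expn_gt0 // subnK.
by rewrite ![gcdn _ (2 ^ m - 1)]gcdnC gcdnDr.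
Qed.

Lemma expn4_pred m : 4 ^ m - 1 = (2 ^ m + 1) * (2 ^ m - 1).
Proof. by rewrite (expnMn 2 2 m); have := expn_gt0 2 m; nia. Qed.

(** [(p - p', q' - q)] solves [x A = y B], whose solutions are the multiples of
    [(B / gcdn A B, A / gcdn A B)]. *)
Lemma lin2_gap A B p q p' q' : 0 < A -> 0 < B ->
  p * A + q * B = p' * A + q' * B -> p' < p -> q + A %/ gcdn A B <= q'.
Proof.
move=> A0 B0 E lt.
have E2 : (p - p') * A = (q' - q) * B by nia.
have ltq : q < q' by nia.
have g0 : 0 < gcdn A B by rewrite gcdn_gt0 A0.
have dv : A %/ gcdn A B %| q' - q.
  rewrite -(dvdn_pmul2r g0) divnK ?dvdn_gcdl //.
  by rewrite muln_gcdr dvdn_gcd dvdn_mull //= -E2 dvdn_mull.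
have := dvdn_leq _ dv; rewrite subn_gt0 => /(_ ltq); lia.
Qed.

(** * Ways with bases at most 3 *)

Definition small (w : seq nat) : bool := all (fun a => 0 < a <= 3) w.

Lemma size_small w : small w ->
  size w = count_mem 1 w + count_mem 2 w + count_mem 3 w.
Proof. by elim: w => //= a w IH /andP[+ /IH ->]; case: a => [|[|[|[|]]]] //=; lia. Qed.

Lemma sum_small m w : small w ->
  \sum_(a <- w) a ^ m =
    size w + (count_mem 3 w * (3 ^ m - 1) + count_mem 2 w * (2 ^ m - 1)).
Proof.
elim: w => [|a w IH] /=; first by rewrite big_nil.
rewrite big_cons => /andP[+ /IH ->].
have := expn_gt0 3 m; have := expn_gt0 2 m.
by case: a => [|[|[|[|]]]] //= ; rewrite ?exp1n; nia.
Qed.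

Lemma perm_small w1 w2 : small w1 -> small w2 -> size w1 = size w2 ->
  count_mem 2 w1 = count_mem 2 w2 -> count_mem 3 w1 = count_mem 3 w2 ->
  perm_eq w1 w2.
Proof.
move=> s1 s2 es e2 e3.
have e1 : count_mem 1 w1 = count_mem 1 w2.
  by have := size_small s1; have := size_small s2; lia.
apply/allP => x; rewrite mem_cat => xw.
have : 0 < x <= 3 by case/orP: xw; [apply: (allP s1)|apply: (allP s2)].
by case: x {xw} => [|[|[|[|]]]] //= _; apply/eqP.
Qed.

Lemma is_way_small n m v w : is_way n m v w -> ~~ has (leq 4) w -> small w.
Proof.
case/and3P=> _ /allP pos _ /hasPn lt4; apply/allP => a aw.
by rewrite (pos a aw) /=; have := lt4 a aw; lia.
Qed.

Lemma is_way_small_sum n m v w : is_way n m v w -> small w ->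
  v = n + (count_mem 3 w * (3 ^ m - 1) + count_mem 2 w * (2 ^ m - 1)).
Proof.
by case/and3P=> /eqP <- _ /eqP <- sw; apply: sum_small.
Qed.

(** The ways are determined by their numbers of threes and twos, and trading
    threes for twos costs [(3 ^ m - 1) / gcd] twos at a time. *)
Lemma many_twos n m v w1 w2 : 0 < m ->
  is_way n m v w1 -> is_way n m v w2 -> small w1 -> small w2 ->
  ~~ perm_eq w1 w2 ->
  let k := (3 ^ m - 1) %/ gcdn (3 ^ m - 1) (2 ^ m - 1) in
  k <= count_mem 2 w1 \/ k <= count_mem 2 w2.
Proof.
move=> m0 W1 W2 s1 s2 np k.
have A0 : 0 < 3 ^ m - 1 by rewrite subn_exp_gt0.
have B0 : 0 < 2 ^ m - 1 by rewrite subn_exp_gt0.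
have E := is_way_small_sum W1 s1.
rewrite {1}(is_way_small_sum W2 s2) in E.
have {}E := addnI E.
case: (ltngtP (count_mem 3 w1) (count_mem 3 w2)) => c3.
- by left; have := lin2_gap A0 B0 E c3; rewrite -/k; lia.
- by right; have := lin2_gap A0 B0 (esym E) c3; rewrite -/k; lia.
- case/negP: np; apply: perm_small => //.
    by case/and3P: W1 W2 => /eqP -> _ _ /and3P[/eqP -> _ _].
  by move: E; rewrite c3 => /addnI /eqP; rewrite eqn_pmul2r // => /eqP.
Qed.

(** * Ways with a base at least 4 *)

Lemma sum_pow_ge_size m (w : seq nat) : all (fun a => 0 < a) w ->
  size w <= \sum_(a <- w) a ^ m.
Proof.
elim: w => //= a w IH /andP[a0 /IH le]; rewrite big_cons.
have am : 0 < a ^ m by rewrite expn_gt0 a0.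
lia.
Qed.

Lemma sum_pow_eq_size m (w : seq nat) : 0 < m -> all (fun a => 0 < a) w ->
  \sum_(a <- w) a ^ m = size w -> w = nseq (size w) 1.
Proof.
move=> m0; elim: w => //= a w IH /andP[a0 pw]; rewrite big_cons => E.
have := sum_pow_ge_size m pw; have : 0 < a ^ m by rewrite expn_gt0 a0.
move=> am le; rewrite -IH //; last lia.
congr cons; apply/eqP; rewrite -(eqn_exp2r a 1 m0) exp1n; lia.
Qed.

(** Keep one base at least 4 and lower it to 4, and all the others to 1. *)
Lemma is_way_large n m v w : 0 < m -> is_way n m v w -> has (leq 4) w ->
  n + (4 ^ m - 1) <= v /\
  (n + (4 ^ m - 1) = v -> perm_eq w (4 :: nseq n.-1 1)).
Proof.
move=> m0 /and3P[/eqP sz pos /eqP <-] /hasP[/= a aw a4].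
have pw := perm_to_rem aw.
have pos' : all (fun a => 0 < a) (rem a w).
  by apply/allP => x /mem_rem; apply: (allP pos).
have sz' := size_rem aw; rewrite sz in sz'.
have n0 : 0 < n by rewrite -sz; case: (w) aw.
have -> : \sum_(b <- w) b ^ m = a ^ m + \sum_(b <- rem a w) b ^ m.
  by rewrite (perm_big _ pw) big_cons.
have le4 : 4 ^ m <= a ^ m by rewrite leq_exp2r.
have g4 : 0 < 4 ^ m by rewrite expn_gt0.
move: (sum_pow_ge_size m pos') (sum_pow_eq_size m0 pos'); rewrite sz'.
move: (\sum_(b <- _) b ^ m) => X leX eqX; split; first lia.
move=> E; apply: (perm_trans pw); rewrite eqX; last lia.
suff -> : a = 4 by [].
by apply/eqP; rewrite -(eqn_exp2r a 4 m0); lia.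
Qed.

(** * The lower bound on two ways *)

Definition seed m : nat :=
  minn ((3 ^ m - 1) %/ gcdn (3 ^ m - 1) (2 ^ m - 1)) (2 ^ m + 1).

Lemma seed_gt0 m : 0 < m -> 0 < seed m.
Proof.
move=> m0; have A0 : 0 < 3 ^ m - 1 by rewrite subn_exp_gt0.
rewrite /seed leq_min addn1 andbT divn_gt0 ?gcdn_gt0 ?A0 //.
by rewrite dvdn_leq ?dvdn_gcdl.
Qed.

Lemma seed_excess_le m : seed m * (2 ^ m - 1) <= 4 ^ m - 1.
Proof. by rewrite expn4_pred leq_mul2r geq_minr orbT. Qed.

Lemma has_ways2 n m v w1 w2 :
  is_way n m v w1 -> is_way n m v w2 -> ~~ perm_eq w1 w2 -> has_ways n m 2 v.
Proof. by move=> W1 W2 np; exists [:: w1; w2]; rewrite /= W1 W2 np. Qed.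

Lemma has_ways2_inv n m v : has_ways n m 2 v ->
  exists w1 w2, [/\ is_way n m v w1, is_way n m v w2 & ~~ perm_eq w1 w2].
Proof.
case=> -[|w1 [|w2 [|? ?]]] [] //= _; rewrite !andbT => /andP[W1 W2] np.
by exists w1, w2.
Qed.

(** A four with ones is a way at the excess of [seed m] twos only when
    [seed m = 2 ^ m + 1]; then the other way can contain a three only if
    [3 ^ m - 1] divides [4 ^ m - 1], which parity forbids. *)
Lemma seed_le_mixed n m v w1 w2 : 0 < m ->
  is_way n m v w1 -> is_way n m v w2 -> ~~ perm_eq w1 w2 ->
  has (leq 4) w1 -> v = n + seed m * (2 ^ m - 1) -> seed m <= n.
Proof.
move=> m0 W1 W2 np L1 Ev.
have [le1 eq1] := is_way_large m0 W1 L1.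
have leM := seed_excess_le m.
have E4 : seed m * (2 ^ m - 1) = 4 ^ m - 1 by lia.
have A0 : 0 < 3 ^ m - 1 by rewrite subn_exp_gt0.
have B0 : 0 < 2 ^ m - 1 by rewrite subn_exp_gt0.
have Es : seed m = 2 ^ m + 1.
  by apply/eqP; rewrite -(eqn_pmul2r B0) E4 expn4_pred.
have [L2|S2] := boolP (has (leq 4) w2).
  have [_ eq2] := is_way_large m0 W2 L2.
  case/negP: np; apply: (perm_trans (eq1 _)); first by rewrite -E4.
  by rewrite perm_sym eq2 // -E4.
have s2 := is_way_small W2 S2.
have := is_way_small_sum W2 s2; rewrite Ev => /addnI.
have := size_small s2; case/and3P: W2 => /eqP -> _ _.
set p := count_mem 3 w2; set q := count_mem 2 w2 => sz E.
have [p0|p_gt0] := posnP p.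
  suff: seed m = q by lia.
  by apply/eqP; rewrite -(eqn_pmul2r B0) E p0.
(* [seed m] twos have the same excess, although they need not fit in [n]. *)
have E' : p * (3 ^ m - 1) + q * (2 ^ m - 1) =
    0 * (3 ^ m - 1) + seed m * (2 ^ m - 1) by rewrite E.
have := lin2_gap A0 B0 E' p_gt0.
have : seed m <= (3 ^ m - 1) %/ gcdn (3 ^ m - 1) (2 ^ m - 1) by apply: geq_minl.
move=> h1 h2; have q0 : q = 0 by lia.
(* [p (3 ^ m - 1)] is even and [4 ^ m - 1] is odd. *)
move: E; rewrite E4 q0 addn0 => /(congr1 odd).
by rewrite oddM !oddB ?expn_gt0 // !oddX /= !orbT andbF (gtn_eqF m0).
Qed.

(** The first part gives the minimality of the values; the second one says that
    with fewer than [seed m] terms the minimal excess is not reached, so the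
    seed number is no smaller. *)
Lemma two_ways_bound n m v : 0 < m -> has_ways n m 2 v ->
  n + seed m * (2 ^ m - 1) <= v /\
  (v = n + seed m * (2 ^ m - 1) -> seed m <= n).
Proof.
move=> m0 /has_ways2_inv[w1 [w2 [W1 W2 np]]].
have leM := seed_excess_le m.
have [L1|S1] := boolP (has (leq 4) w1).
  split; last exact: seed_le_mixed W1 W2 np L1.
  by have [le _] := is_way_large m0 W1 L1; lia.
have [L2|S2] := boolP (has (leq 4) w2).
  rewrite perm_sym in np; split; last exact: seed_le_mixed W2 W1 np L2.
  by have [le _] := is_way_large m0 W2 L2; lia.
have s1 := is_way_small W1 S1; have s2 := is_way_small W2 S2.
have : seed m <= (3 ^ m - 1) %/ gcdn (3 ^ m - 1) (2 ^ m - 1) by apply: geq_minl.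
have tw w : is_way n m v w -> small w -> seed m <= count_mem 2 w ->
    n + seed m * (2 ^ m - 1) <= v /\ seed m <= n.
  move=> W sw le; rewrite (is_way_small_sum W sw) leq_add2l.
  have := size_small sw; case/and3P: W => /eqP -> _ _ sz; split; last lia.
  by apply: leq_trans (leq_addl _ _); rewrite leq_mul2r le orbT.
move=> lek; case: (many_twos m0 W1 W2 s1 s2 np) => le.
- by have [] := tw _ W1 s1 (leq_trans lek le).
- by have [] := tw _ W2 s2 (leq_trans lek le).
Qed.

(** * Attaining the bound *)

Lemma sum_nseq_pow m k a : \sum_(b <- nseq k a) b ^ m = k * a ^ m.
Proof. by rewrite big_nseq iter_addn_0 mulnC. Qed.

Lemma is_way_nseq k m a : 0 < a -> is_way k m (k * a ^ m) (nseq k a).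
Proof. by move=> a0; rewrite /is_way size_nseq sum_nseq_pow !eqxx all_nseq a0 orbT. Qed.

Lemma is_way_cat n n' m v v' w w' : is_way n m v w -> is_way n' m v' w' ->
  is_way (n + n') m (v + v') (w ++ w').
Proof.
case/and3P=> /eqP <- p /eqP <- /and3P[/eqP <- p' /eqP <-].
by rewrite /is_way size_cat big_cat all_cat p p' !eqxx.
Qed.

(** The trade is with one four if [2 ^ m + 1] is the smaller argument of the
    minimum, and with threes, in the number given by the primitive solution,
    otherwise. *)
Lemma twos_trade m : 0 < m ->
  exists2 w, is_way (seed m) m (seed m * 2 ^ m) w & 2 \notin w.
Proof.
move=> m0; rewrite /seed.
have A0 : 0 < 3 ^ m - 1 by rewrite subn_exp_gt0.
have B0 : 0 < 2 ^ m - 1 by rewrite subn_exp_gt0.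
set A := 3 ^ m - 1 in A0 *; set B := 2 ^ m - 1 in B0 *; set g := gcdn A B.
have [le|_] := leqP (A %/ g) (2 ^ m + 1); last first.
  exists (nseq 1 4 ++ nseq (2 ^ m) 1); last first.
    by rewrite mem_cat !mem_nseq /= andbF.
  have := is_way_cat (is_way_nseq 1 m (isT : 0 < 4))
                     (is_way_nseq (2 ^ m) m (isT : 0 < 1)).
  by rewrite exp1n mul1n muln1 addnC (expnMn 2 2 m) mulnDl mul1n.
have g0 : 0 < g by rewrite gcdn_gt0 A0.
have AB : B <= A by rewrite /A /B leq_sub2r // leq_exp2r.
have pA : B %/ g <= A %/ g by rewrite leq_div2r.
exists (nseq (B %/ g) 3 ++ nseq (A %/ g - B %/ g) 1); last first.
  by rewrite mem_cat !mem_nseq /= !andbF.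
have := is_way_cat (is_way_nseq (B %/ g) m (isT : 0 < 3))
                   (is_way_nseq (A %/ g - B %/ g) m (isT : 0 < 1)).
rewrite exp1n muln1 subnKC //.
have EAB : B %/ g * A = A %/ g * B.
  by rewrite mulnC muln_divCA_gcd mulnC.
have -> : 3 ^ m = A + 1 by rewrite subnK ?expn_gt0.
have -> : 2 ^ m = B + 1 by rewrite subnK ?expn_gt0.
by congr is_way; nia.
Qed.

(** The [j] extra terms are ones, which add nothing to the excess. *)
Lemma is_T_seed m j : 0 < m -> is_T (seed m + j) m 2 (seed m * 2 ^ m + j).
Proof.
move=> m0; have g2 := expn_gt0 2 m; split.
  have [w W w2] := twos_trade m0.
  have I : is_way j m j (nseq j 1).
    by have := is_way_nseq j m (isT : 0 < 1); rewrite exp1n muln1.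
  have T := is_way_nseq (seed m) m (isT : 0 < 2).
  apply: has_ways2 (is_way_cat T I) (is_way_cat W I) _.
  rewrite perm_cat2r; apply: contra w2 => /perm_mem <-.
  by rewrite mem_nseq seed_gt0.
by move=> u /(two_ways_bound m0)[le _]; nia.
Qed.

Unset Implicit Arguments.

Theorem theorem3p6 (m : nat) (hm : 0 < m) :
  let d := gcdn (3 ^ m - 2 ^ m) (2 ^ m - 1) in
  let s0 := minn ((3 ^ m - 1) %/ d) (2 ^ m + 1) in
  [/\ is_seed_number m 2 s0,
      is_seed_value m 2 (s0 * 2 ^ m)
    & forall j : nat, is_T (s0 + j) m 2 (s0 * 2 ^ m + j)].
Proof.
move=> d s0.
have -> : s0 = seed m by rewrite /s0 /d gcdn_pow3.
have T j := is_T_seed j hm.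
have T0 : is_T (seed m) m 2 (seed m * 2 ^ m) by have := T 0; rewrite !addn0.
suff S : is_seed_number m 2 (seed m) by split=> //; exists (seed m).
split; first exact: seed_gt0.
  move=> n le; exists (seed m * 2 ^ m + (n - seed m)).
    by have := T (n - seed m); rewrite subnKC.
  by have := T (n.+1 - seed m); rewrite subnKC ?leqW // subSn // addnS.
move=> s' s'0 sf; rewrite leqNgt; apply/negP => lt.
(* At [n = seed m - 1] the value would have the same excess as at [seed m],
   which takes at least [seed m] terms. *)
have [v [Hv _]] := sf (seed m).-1 ltac:(lia).
have -> : (seed m).-1.+1 = seed m by lia.
move/is_T_inj => /(_ _ T0) Ev.
have [_] := two_ways_bound hm Hv.
have : v = (seed m).-1 + seed m * (2 ^ m - 1) by have := expn_gt0 2 m; nia.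
by move=> -> /(_ erefl); lia.
Qed.
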